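(* $O(n^{0.999})$ cops can catch a robber of speed $2$ on the grid $[n]^2$ for $n$ sufficiently large; that is, there exist a constant $C>0$ and an integer $n_0$ such that for every $n\ge n_0$ there is a number $m\le C\,n^{0.999}$ such that $m$ cops have a winning strategy in the game Catching a Fast Robber, with robber speed $2$, on the grid $[n]^2$.
   Context: The grid $[n]^2$ is the graph with vertex set $\{1,\dots,n\}^2$ in which two distinct vertices are adjacent if and only if each coordinate differs by at most $1$ (so graph distance is the $l_\infty$ distance). Catching a Fast Robber, with robber speed $2$, is the following perfect information game on $[n]^2$. The cops choose their starting vertices (several cops may share a vertex), and then the robber chooses his starting vertex. The two sides then move alternately, the cops going first: on the cops' turn each cop moves to an adjacent vertex or stays put, and on the robber's turn he moves to any vertex at distance at most $2$ from his current vertex (possibly staying put). The robber loses (is caught) if at some point a cop is on the same vertex as him; he wins if he evades the cops forever. A winning strategy for the cops is one guaranteeing that the robber is caught against every play of the robber. *)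

(* Defs.v *)
From mathcomp Require Import all_boot.

Set Implicit Arguments.
Unset Strict Implicit.
Unset Printing Implicit Defensive.

(* The grid [n]^2, with coordinates numbered 0, ..., n-1. *)
Definition grid (n : nat) : finType := ('I_n * 'I_n)%type.

Definition differ_le1 (n : nat) (i j : 'I_n) : bool :=
  (i <= j.+1) && (j <= i.+1).

Definition grid_adj (n : nat) : rel (grid n) :=
  fun x y => [&& x != y, differ_le1 x.1 y.1 & differ_le1 x.2 y.2].

Section Game.

Variables (T : finType) (e : rel T) (s m : nat).

(* Graph distance at most k: some walk with at most k edges joins x to y. *)
Definition dist_le (k : nat) (x y : T) : Prop :=
  exists p : seq T, [/\ path e x p, last x p = y & size p <= k].

Definition cops : Type := {ffun 'I_m -> T}.

Definition cops_move (c c' : cops) : Prop :=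
  forall i, c' i = c i \/ e (c i) (c' i).

(* A strategy gets the whole history of the game: the successive pairs
   (cops, robber), in chronological order, at the times when it was the cops'
   turn to move. Past cop positions are included. *)
Record strategy := Strategy {
  strat_start : cops;
  strat_move : seq (cops * T) -> cops;
  strat_legal : forall h c r, cops_move c (strat_move (rcons h (c, r)))
}.

(* The vertices occupied are c 0, r 0, c 1, r 1, c 2, ... in order of play.
   The robber may move past cops and onto them. *)
Definition robber_play (r : nat -> T) : Prop :=
  forall t, dist_le s (r t) (r t.+1).

Definition follows (S : strategy) (c : nat -> cops) (r : nat -> T) : Prop :=
  c 0 = strat_start S /\
  forall t, c t.+1 = strat_move S [seq (c u, r u) | u <- iota 0 t.+1].

(* Capture can occur either after a robber's move or choice of start
   (c t against r t), or after a cops' move (c t.+1 against r t). *)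
Definition caught (c : nat -> cops) (r : nat -> T) : Prop :=
  exists t i, c t i = r t \/ c t.+1 i = r t.

Definition winning (S : strategy) : Prop :=
  forall c r, robber_play r -> follows S c r -> caught c r.

Definition cops_win : Prop := exists S : strategy, winning S.

End Game.

(* Main.v *)
From Stdlib Require Import ZArith Lia Classical.
Require Import Defs.
From mathcomp Require Import all_boot all_order all_algebra.
From mathcomp Require Import reals exp.
From mathcomp Require Import zify.

Import Order.TTheory GRing.Theory Num.Theory.

(** Measured by x - y and x + y, the graph distance of the grid becomes half the
    l1 distance.  In l1, a wall of height h at right angles to a line is a real
    obstacle: points of the line at distances p and q on either side of its foot
    are p + q apart, but the robber walks p + q + 2h from one to the other.  When
    2h > p + q this takes a robber of speed 2 longer than it takes a cop to go
    straight through the wall, so a single cop can guard both points.  Guarding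
    the wall costs only about h cops, as its two faces are in the same place, and
    these save up to 2h cops on the line.

    The saving is iterated.  A unit of level k + 1 consists of 160 consecutive
    units of level k and of a wall at its middle, 22 units of level k high on each
    face.  They form 157 clusters: 28 pairs around the foot of the wall, 19 pairs
    of opposite faces, and single units otherwise (104 on the line, and 3 on each
    face near the tip, where the detour is too short).  The units of a cluster are
    guarded by the same cops, so level k takes 157 ^ k groups of boundedly many
    cops for a line of length 200 * 160 ^ k, and 157 ^ 1000 <= 160 ^ 999.

    All walls, of all levels, form one maze that is fixed once and for all, and
    each cop's position is a function of the robber's.  A group in charge of
    places q follows McShane's extension formula, the minimum over q of the
    position of q plus a penalty that vanishes when the robber is at q.  This is
    right at every q because the penalty of q exceeds the distance between q and
    q' when the robber is at q' ([penalty_other], [guide_value]), and it changes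
    slowly along every step that does not go through a wall ([guide_step]).

    The penalties grow at rate 15/32 only, not 1/2, so the cops have speed to
    spare, and the whole maze can creep over the grid.  It starts so far away that
    every cop waits in a corner whatever the robber does, and ends beyond the
    opposite corner.  The robber is always in front of it until he lands in a
    guarded place, where a cop is ([robber_reaches_guard], [plan_hit]). *)

(** * Following a plan *)

(** The position prescribed for each cop depends on the time and on the robber's
    position alone.  A strategy must answer every history, including those in
    which the plan asks for an illegal move: such a cop stays put.  The
    hypothesis on [plan 0] makes the cops' start independent of the robber's. *)
Lemma cops_win_of_plan (T : finType) (e : rel T) (s : nat) (I : finType)
    (x0 : T) (plan : nat -> T -> I -> T) :
  (forall r, robber_play e s r ->
     (forall i, plan 0 (r 0) i = x0) /\
     exists t, (exists i, plan t (r t) i = r t) /\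
       forall u, u < t -> forall i,
         plan u.+1 (r u.+1) i = plan u (r u) i \/
         e (plan u (r u) i) (plan u.+1 (r u.+1) i)) ->
  cops_win e s #|I|.
Proof.
move=> plan_ok; pose start : cops T #|I| := [ffun => x0].
pose move_to (c c' : cops T #|I|) : cops T #|I| :=
  [ffun i => if (c' i == c i) || e (c i) (c' i) then c' i else c i].
pose goal t x : cops T #|I| := [ffun i => plan t x (enum_val i)].
pose next h := let: (c, x) := last (start, x0) h in move_to c (goal (size h).-1 x).
have next_legal h c x : cops_move e c (next (rcons h (c, x))).
  move=> i; rewrite /next last_rcons ffunE.
  by case: ifP => [/predU1P[->|]|_]; [left | right | left].
exists (Strategy start next_legal) => c r r_play [c0 c_next].
have [plan0 [t [[i hit] steps]]] := plan_ok r r_play.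
have c_step u : c u.+1 = move_to (c u) (goal u (r u)).
  rewrite c_next -[LHS]/(next _) /next size_map size_iota.
  by rewrite -[in iota _ _]addn1 iotaD map_cat cats1 last_rcons.
suff c_goal u : u <= t -> c u.+1 = goal u (r u).
  exists t, (enum_rank i); right.
  by rewrite c_goal // ffunE enum_rankK.
elim: u => [_|u IH lt_ut]; apply/ffunP => j; rewrite c_step ffunE.
  by rewrite c0 /= !ffunE plan0 eqxx.
rewrite (IH (ltnW lt_ut)) !ffunE.
by case: (steps u lt_ut (enum_val j)) => [->|->]; rewrite ?eqxx ?orbT.
Qed.

(** * The maze *)

Section Maze.
Local Open Scope Z_scope.

Local Arguments Z.mul : simpl never.
Local Arguments Z.add : simpl never.
Local Arguments Z.sub : simpl never.
Local Arguments Z.max : simpl never.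
Local Arguments Z.min : simpl never.
Local Arguments Z.abs : simpl never.
Local Arguments Z.of_nat : simpl never.

Definition point : Type := (Z * Z)%type.

Definition l1 (w w' : point) : Z := Z.abs (w.1 - w'.1) + Z.abs (w.2 - w'.2).

(** The unit of level k in local coordinates: it lies on the axis from (0, 0) to
    (len k, 0) and is to be guarded against a robber above the axis.  With l the
    length of its pieces, [Base i] is the i-th piece of the axis, and [WallL j] and
    [WallR j] are the pieces at height j of the left and right face of the wall,
    which rises at the middle 80 * l.  The axis of [WallR] is at distance 1 to the
    left of the wall and pieces guard heights 1 and above, so the guarded strips of the
    two faces touch without overlapping. *)
Inductive piece := Base of Z | WallL of Z | WallR of Z.

Definition to_local (l : Z) (s : piece) (w : point) : point :=
  match s with
  | Base i => (w.1 - i * l, w.2)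
  | WallL j => (w.2 - 1 - j * l, 80 * l - w.1)
  | WallR j => (w.2 - 1 - j * l, w.1 - 80 * l + 1)
  end.

Definition of_local (l : Z) (s : piece) (w : point) : point :=
  match s with
  | Base i => (w.1 + i * l, w.2)
  | WallL j => (80 * l - w.2, w.1 + 1 + j * l)
  | WallR j => (w.2 + 80 * l - 1, w.1 + 1 + j * l)
  end.

Definition cluster : finType :=
  ('I_52 + 'I_52 + ('I_28 + ('I_19 + ('I_3 + 'I_3))))%type.

Definition member (c : cluster) (right : bool) : piece :=
  match c with
  | inl (inl i) => Base (Z.of_nat i)
  | inl (inr i) => Base (108 + Z.of_nat i)
  | inr (inl i) => Base ((if right then 80 else 52) + Z.of_nat i)
  | inr (inr (inl j)) => (if right then WallR else WallL) (Z.of_nat j)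
  | inr (inr (inr (inl j))) => WallL (19 + Z.of_nat j)
  | inr (inr (inr (inr j))) => WallR (19 + Z.of_nat j)
  end.

(** In units of l, a lower bound for the absolute value of [detour] at the guarded
    places of the member [right] of a pair.  In a cluster whose two members are
    equal, the value -80 makes both penalties vanish, as [detour] is at most
    80 * l in absolute value. *)
Definition reach (c : cluster) (right : bool) : Z :=
  match c with
  | inr (inl i) => if right then 21 + Z.of_nat i else 48 - Z.of_nat i
  | inr (inr (inl j)) => 21 - Z.of_nat j
  | _ => -80
  end.

(** The l1 distance to the vertical ray above the tip of the wall, negative on the
    left.  It jumps only across the wall and the axis.  The minimum with the
    distance to the border of the l1 ball of radius 80 * l around the foot makes it
    vanish before the ends of the unit, so that what surrounds the unit does not
    matter. *)
Definition detour (l : Z) (w : point) : Z :=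
  let a := w.1 - 80 * l in
  let g := Z.max 0 (Z.min (Z.abs a + Z.max 0 (22 * l - w.2))
                          (80 * l - Z.abs a - w.2)) in
  if w.2 <=? 0 then 0 else if a <? 0 then - g else g.

(** A multiple of how far the robber has come from member [right] of the cluster on
    his way around the wall.  Positions are scaled by 32 below, so the factor 15
    means 15/32 in l1 distance. *)
Definition penalty (l : Z) (c : cluster) (right : bool) (w : point) : Z :=
  15 * Z.max 0 (reach c right * l + (if right then - detour l w else detour l w)).

Fixpoint len (k : nat) : Z := if k is k'.+1 then 160 * len k' else 200.

(** The places guarded by the group with address a.  At level 0 the guarded strip is
    49 deep, the length of the longest step of the robber relative to the maze, so
    he cannot jump over it. *)
Fixpoint guarded (a : seq cluster) (w : point) : Prop :=
  if a is c :: a' then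
    exists b, guarded a' (to_local (len (size a')) (member c b) w)
  else 0 <= w.1 < 200 /\ 1 <= w.2 <= 49.

(** McShane's formula for the group with address a, evaluated along the tree of its
    places: the minimum over these of 32 times phi at the place plus the largest of
    d and the penalties on the path leading to it.  Taking the largest penalty and
    not their sum keeps the Lipschitz constant from growing with the level.  The
    function phi stands for one grid coordinate, rewritten in the local coordinates
    of the current unit. *)
Fixpoint guide (a : seq cluster) (phi : point -> Z) (d : Z) (w : point) : Z :=
  if a is c :: a' then
    let l := len (size a') in
    let go b := guide a' (fun z => phi (of_local l (member c b) z))
                  (Z.max d (penalty l c b w)) (to_local l (member c b) w) in
    Z.min (go false) (go true)
  else 32 * phi (0, 0) + d.

Lemma len_ge k : 200 <= len k.
Proof. by elim: k => [|k IH] /=; lia. Qed.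

Lemma to_localK l s w : of_local l s (to_local l s w) = w.
Proof. by case: s w => i [u v] /=; congr pair; lia. Qed.

Lemma of_localK l s w : to_local l s (of_local l s w) = w.
Proof. by case: s w => i [u v] /=; congr pair; lia. Qed.

Lemma l1_of_local l s w w' : l1 (of_local l s w) (of_local l s w') = l1 w w'.
Proof. by case: s => i; rewrite /l1 /=; lia. Qed.

Lemma l1_to_local l s w w' : l1 (to_local l s w) (to_local l s w') = l1 w w'.
Proof. by rewrite -[in RHS](to_localK l s w) -[in RHS](to_localK l s w') l1_of_local. Qed.

Definition piece_in_range (s : piece) : Prop :=
  match s with
  | Base i => 0 <= i < 160
  | WallL j | WallR j => 0 <= j < 22
  end.

Lemma member_range c b : piece_in_range (member c b).
Proof.
case: c => [[[i lt_i]|[i lt_i]]|[[i lt_i]|[[i lt_i]|[[i lt_i]|[i lt_i]]]]] //=;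
  case: b => /=; lia.
Qed.

Lemma member_surj s : piece_in_range s -> exists c b, member c b = s.
Proof.
have ord (m : nat) i : 0 <= i < Z.of_nat m -> exists i' : 'I_m, Z.of_nat i' = i.
  move=> i_m; have lt_i : (Z.to_nat i < m)%N by lia.
  by exists (Ordinal lt_i) => /=; lia.
case: s => i /= i_in.
- have [lt_52|ge_52] := Z.lt_ge_cases i 52.
    have [i' <-] := ord 52%N i ltac:(lia).
    by exists (inl (inl i')), false.
  have [lt_80|ge_80] := Z.lt_ge_cases i 80.
    have [i' i'E] := ord 28%N (i - 52) ltac:(lia).
    by exists (inr (inl i')), false => /=; congr Base; lia.
  have [lt_108|ge_108] := Z.lt_ge_cases i 108.
    have [i' i'E] := ord 28%N (i - 80) ltac:(lia).
    by exists (inr (inl i')), true => /=; congr Base; lia.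
  have [i' i'E] := ord 52%N (i - 108) ltac:(lia).
  by exists (inl (inr i')), false => /=; congr Base; lia.
- have [lt_19|ge_19] := Z.lt_ge_cases i 19.
    have [i' <-] := ord 19%N i ltac:(lia).
    by exists (inr (inr (inl i'))), false.
  have [i' i'E] := ord 3%N (i - 19) ltac:(lia).
  by exists (inr (inr (inr (inl i')))), false => /=; congr WallL; lia.
- have [lt_19|ge_19] := Z.lt_ge_cases i 19.
    have [i' <-] := ord 19%N i ltac:(lia).
    by exists (inr (inr (inl i'))), true.
  have [i' i'E] := ord 3%N (i - 19) ltac:(lia).
  by exists (inr (inr (inr (inr i')))), false => /=; congr WallR; lia.
Qed.

(** * Where the guards are *)

(** The structure of a unit stays over its base, so those of different pieces of the
    axis are disjoint, and below a quarter of its length. *)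
Lemma guarded_box a w : guarded a w ->
  0 <= w.1 < len (size a) /\ 1 <= w.2 /\ 4 * w.2 <= len (size a).
Proof.
elim: a w => [|c a IH] w /=; first by lia.
case=> b /IH; have := member_range c b; have := len_ge (size a).
by case: (member c b) => i /=; nia.
Qed.

Lemma strip_guarded k w : 0 <= w.1 < len k -> 1 <= w.2 <= 49 ->
  exists2 a, size a = k & guarded a w.
Proof.
elim: k w => [|k IH] w /= w1 w2; first by exists [::].
have l_ge := len_ge k; set i := w.1 / len k.
have i_eq := Z.div_mod w.1 (len k) ltac:(lia).
have i_mod := Z.mod_pos_bound w.1 (len k) ltac:(lia).
have [c [b cE]] := member_surj (Base i) ltac:(rewrite /= /i; nia).
have [] := IH (to_local (len k) (member c b) w); rewrite ?cE /= ?/i; try lia.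
move=> a sz_a aP; exists (c :: a); rewrite /= sz_a //.
by exists b; rewrite cE.
Qed.

(** The strips along the two faces make the wall a solid rectangle, on either
    side as deep as a step. *)
Lemma wall_guarded k w :
  1 <= w.2 <= 22 * len k -> -49 <= w.1 - 80 * len k <= 48 ->
  exists2 a, size a = k.+1 & guarded a w.
Proof.
move=> w2 w1; have l_ge := len_ge k; set j := (w.2 - 1) / len k.
have j_eq := Z.div_mod (w.2 - 1) (len k) ltac:(lia).
have j_mod := Z.mod_pos_bound (w.2 - 1) (len k) ltac:(lia).
have j_in : 0 <= j < 22 by rewrite /j; nia.
(* The left face owns the points left of the middle, the right face the others. *)
pose s := if w.1 <? 80 * len k then WallL j else WallR j.
have [c [b cE]] := member_surj s ltac:(rewrite /s; case: ifP => //).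
have [||a sz_a aP] := @strip_guarded k (to_local (len k) s w).
- by rewrite /s /j; case: ifP => /=; lia.
- by rewrite /s; case: ifP => /=; lia.
by exists (c :: a) => /=; [rewrite sz_a | exists b; rewrite sz_a cE].
Qed.

(** * Distances in the maze *)

(** A step changes [detour] by more than its length only if it crosses the wall
    below the tip, or the axis of the unit inside the ball where [detour] is
    nonzero.  Both are surrounded by strips as deep as a step, where a free robber
    cannot start. *)
Lemma detour_step l (free : point -> Prop) w w' :
  200 <= l ->
  (forall z, 0 <= z.1 < 160 * l -> -49 < z.2 <= 49 -> ~ free z) ->
  (forall z, 1 <= z.2 <= 22 * l -> -49 <= z.1 - 80 * l <= 48 -> ~ free z) ->
  free w -> l1 w w' <= 49 ->
  Z.abs (detour l w - detour l w') <= l1 w w'.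
Proof.
move=> l_ge base_blocked wall_blocked free_w.
have {}base_blocked : ~ (0 <= w.1 < 160 * l /\ -49 < w.2 <= 49).
  by case=> ? ?; apply: (base_blocked w).
have {}wall_blocked : ~ (1 <= w.2 <= 22 * l /\ -49 <= w.1 - 80 * l <= 48).
  by case=> ? ?; apply: (wall_blocked w).
rewrite /detour /l1; case: w w' free_w base_blocked wall_blocked => [x y] [x' y'] /= _.
by case: (Z.leb_spec y 0) => ?; case: (Z.leb_spec y' 0) => ?;
  case: (Z.ltb_spec (x - 80 * l) 0) => ?;
  case: (Z.ltb_spec (x' - 80 * l) 0) => ?; lia.
Qed.

Lemma detour_bound l w : 0 <= l -> Z.abs (detour l w) <= 80 * l.
Proof.
rewrite /detour => l_ge; case: (Z.leb_spec w.2 0) => ?; first by lia.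
by case: (Z.ltb_spec (w.1 - 80 * l) 0) => ?; lia.
Qed.

Lemma penalty_ge0 l c b w : 0 <= penalty l c b w.
Proof. by rewrite /penalty; lia. Qed.

Lemma penalty_le l c b w : 0 <= l -> penalty l c b w <= 15 * (160 * l).
Proof.
move=> l_ge; have := detour_bound l w l_ge.
have : reach c b * l <= 80 * l.
  apply: Z.mul_le_mono_nonneg_r => //.
  by case: c => [[[i /= ?]|[i /= ?]]|[[i /= ?]|[[i /= ?]|[[i /= ?]|[i /= ?]]]]];
    case: b; lia.
by rewrite /penalty; case: b; lia.
Qed.

Definition in_box (l : Z) (w : point) : Prop :=
  0 <= w.1 < l /\ 1 <= w.2 /\ 4 * w.2 <= l.

Lemma penalty_own l c b w : 200 <= l -> in_box l (to_local l (member c b) w) ->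
  penalty l c b w = 0.
Proof.
move=> l_ge.
have solo : reach c b = -80 -> penalty l c b w = 0.
  move=> rE; have := @detour_bound l w ltac:(lia).
  by rewrite /penalty rE; case: b {rE} => ?; lia.
case: c solo => [[i|i] solo|[[i /= lt_i] _|[[i /= lt_i] _|[i|i] solo]]];
  try by move=> _; apply: solo.
all: rewrite /in_box /penalty /detour; case: w => x y.
all: have ? : 0 <= Z.of_nat i * l by nia.
  have ? : Z.of_nat i * l <= 27 * l by nia.
  by case: b => /=; rewrite ?Z.mul_add_distr_r ?Z.mul_sub_distr_r => box;
    case: (Z.leb_spec y 0) => ?; case: (Z.ltb_spec (x - 80 * l) 0) => ?; lia.
have ? : Z.of_nat i * l <= 18 * l by nia.
by case: b => /=; rewrite ?Z.mul_sub_distr_r => box;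
    case: (Z.leb_spec y 0) => ?; case: (Z.ltb_spec (x - 80 * l) 0) => ?; lia.
Qed.

(** The heart of the construction: at a place of one member, the penalty of the other
    pays for the distance between the members and for their extent.  For a pair on
    the axis, the reaches add up to 69 while the members are 28 apart, and
    15 * 69 >= 32 * 28 + 80; opposite pieces of the faces are at distance 1,
    their reaches add up to at least 6, and 15 * 6 > 80. *)
Lemma penalty_other l c b w : 200 <= l ->
  in_box l (to_local l (member c b) w) ->
  member c b = member c (~~ b) /\ penalty l c (~~ b) w = 0 \/
  32 * l1 (of_local l (member c b) (0, 0)) (of_local l (member c (~~ b)) (0, 0))
    + 80 * l <= penalty l c (~~ b) w.
Proof.
move=> l_ge box; have own := penalty_own l c b w l_ge box.
have solo : reach c b = -80 -> reach c (~~ b) = -80 -> penalty l c (~~ b) w = 0.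
  move=> _ rE; have := @detour_bound l w ltac:(lia).
  by rewrite /penalty rE; case: b {rE box own} => /= ?; lia.
case: c box own solo
  => [[i|i] _ _ solo|[[i /= lt_i] _ own _|[[i /= lt_i] _ own _|[i|i] _ _ solo]]];
  try by left; split; [case: (b) | apply: solo].
all: right; move: own; rewrite /penalty /l1.
all: have ? : 0 <= Z.of_nat i * l by nia.
  have ? : Z.of_nat i * l <= 27 * l by nia.
  by case: b => /=; rewrite ?Z.mul_add_distr_r ?Z.mul_sub_distr_r; lia.
have ? : Z.of_nat i * l <= 18 * l by nia.
by case: b => /=; rewrite ?Z.mul_sub_distr_r; lia.
Qed.

Definition nonexpansive (phi : point -> Z) : Prop :=
  forall z z', Z.abs (phi z - phi z') <= l1 z z'.

Lemma nonexpansive_local phi l s :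
  nonexpansive phi -> nonexpansive (fun z => phi (of_local l s z)).
Proof. by move=> phi1 z z'; rewrite -(l1_of_local l s). Qed.

Lemma origin_near k c b :
  let l := len k in
  4 * l1 (0, 0) (of_local l (member c b) (0, 0)) + 5 * l <= 5 * len k.+1.
Proof.
move=> l; have := member_range c b; have := len_ge k.
by rewrite /l1 /= -/l; case: (member c b) => i /= ? ?; nia.
Qed.

(** * The position of a group *)

(** All places of the group lie within 5/4 of the length of the unit from its
    origin, and 40 = 32 * 5/4. *)
Lemma guide_lower a phi d w : nonexpansive phi -> 0 <= d ->
  32 * phi (0, 0) - 40 * len (size a) + d <= guide a phi d w.
Proof.
elim: a phi d w => [|c a IH] phi d w phi1 d_ge /=; first by rewrite /=; lia.
suff go b : 32 * phi (0, 0) - 40 * (160 * len (size a)) + d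
   <= guide a (fun z => phi (of_local (len (size a)) (member c b) z))
        (Z.max d (penalty (len (size a)) c b w))
        (to_local (len (size a)) (member c b) w).
  by apply: Z.min_glb.
have := @IH _ (Z.max d (penalty (len (size a)) c b w))
   (to_local (len (size a)) (member c b) w)
   (nonexpansive_local phi (len (size a)) (member c b) phi1) ltac:(lia).
have := origin_near (size a) c b => /=.
have := phi1 (0, 0) (of_local (len (size a)) (member c b) (0, 0)).
by move: (guide _ _ _ _) (phi (of_local _ _ _)) (l1 _ _) => g v r; lia.
Qed.

Lemma guide_upper a phi d w : nonexpansive phi ->
  guide a phi d w <=
    32 * phi (0, 0) + 40 * len (size a) + Z.max d (15 * len (size a)).
Proof.
elim: a phi d w => [|c a IH] phi d w phi1 /=; first by rewrite /=; lia.
apply: Z.le_trans; first exact: Z.le_min_l.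
have := @IH _ (Z.max d (penalty (len (size a)) c false w))
   (to_local (len (size a)) (member c false) w)
   (nonexpansive_local phi (len (size a)) (member c false) phi1).
have := origin_near (size a) c false => /=.
have := phi1 (0, 0) (of_local (len (size a)) (member c false) (0, 0)).
have := len_ge (size a).
have := penalty_le (len (size a)) c false w.
move: (guide _ _ _ _) (phi (of_local _ _ _)) (l1 _ _) => g v r.
by move: (penalty _ _ _ _) => p; move: (len _) (phi _) => l f; lia.
Qed.

(** When the robber is at one of the places of the group, all penalties on the path to
    it vanish, and every other branch loses by [penalty_other].  The witness pi is phi
    at the corner of the level 0 unit where the robber is, of size 200 by 49. *)
Lemma guide_value a phi w : nonexpansive phi -> guarded a w ->
  exists2 pi, guide a phi 0 w = 32 * pi &
    Z.abs (phi w - pi) <= 248 /\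
    4 * Z.abs (phi (0, 0) - pi) <= 5 * len (size a).
Proof.
elim: a phi w => [|c a IH] phi w phi1 /=.
  move=> w_in; exists (phi (0, 0)); first by lia.
  by have := phi1 w (0, 0); rewrite /l1 /=; lia.
case=> b w_in; have l_ge := len_ge (size a); set l := len (size a) in w_in l_ge *.
have box : in_box l (to_local l (member c b) w) by apply: guarded_box.
have phi1' b' := nonexpansive_local phi l (member c b') phi1.
have [pi val [near_w near_0]] := IH _ _ (phi1' b) w_in.
rewrite to_localK -/l in near_w near_0.
exists pi; last first.
  have := phi1 (0, 0) (of_local l (member c b) (0, 0)).
  have := origin_near (size a) c b; move: near_w near_0; rewrite /= -/l.
  by move: (phi (of_local _ _ _)) (l1 _ _) => v r; lia.
set go := fun b' => guide a (fun z => phi (of_local l (member c b') z))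
                  (Z.max 0 (penalty l c b' w)) (to_local l (member c b') w).
rewrite -[LHS]/(Z.min (go false) (go true)).
have go_b : go b = 32 * pi by rewrite /go penalty_own.
suff : 32 * pi <= go (~~ b) by case: (b) go_b => /=; lia.
rewrite /go; have [[<- ->]|far] := penalty_other l c b w l_ge box.
  by rewrite val; lia.
have := @guide_lower a _ (Z.max 0 (penalty l c (~~ b) w))
   (to_local l (member c (~~ b)) w) (phi1' (~~ b)) ltac:(lia).
have := phi1 (of_local l (member c b) (0, 0)) (of_local l (member c (~~ b)) (0, 0)).
by move: far; rewrite -/l; move: (guide _ _ _ _) (l1 _ _) => g r; lia.
Qed.

(** Free positions are those a robber who has not been caught may be in.  The
    two hypotheses on them pass to the pieces: those on the axis inherit the
    blocked strip around it, and each face of the wall is protected from behind by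
    the other face.  The 1 by which phi and phi' may differ is the motion of the
    maze in one turn. *)
Lemma guide_step a (free : point -> Prop) phi phi' d d' w w' :
  (forall z, Z.abs (phi z - phi' z) <= 1) ->
  (forall z, 0 <= z.1 < len (size a) -> -49 < z.2 <= 49 -> ~ free z) ->
  (forall a' z, size a' = size a -> guarded a' z -> ~ free z) ->
  free w -> l1 w w' <= 49 -> Z.abs (d - d') <= 15 * 49 ->
  Z.abs (guide a phi d w - guide a phi' d' w') <= 32 + 15 * 49.
Proof.
elim: a free phi phi' d d' w w' => [|c a IH] free phi phi' d d' w w'.
  by move=> /(_ (0, 0)) /=; lia.
move=> phi_phi' base_blocked guarded_blocked free_w step_w dd'.
have l_ge := len_ge (size a); set l := len (size a) in l_ge *.
have wall_blocked z : 1 <= z.2 <= 22 * l -> -49 <= z.1 - 80 * l <= 48 -> ~ free z.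
  by move=> z2 z1; have [a' sz_a' a'z] := wall_guarded _ z z2 z1;
    apply: guarded_blocked a'z.
have pen := detour_step l free w w' l_ge base_blocked wall_blocked free_w step_w.
rewrite /= -/l.
set go := fun phi d b w => guide a (fun z => phi (of_local l (member c b) z))
                  (Z.max d (penalty l c b w)) (to_local l (member c b) w).
suff go_step b : Z.abs (go phi d b w - go phi' d' b w') <= 32 + 15 * 49.
  by have := go_step false; have := go_step true; rewrite /go; lia.
apply: (IH (fun z => free (of_local l (member c b) z))); rewrite ?to_localK ?l1_to_local //.
- rewrite -/l => z z1 z2; have := member_range c b.
  case: (member c b) => j /= j_in.
  + by apply: base_blocked => /=; rewrite -/l /=; nia.
  + by apply: wall_blocked => /=; nia.
  + by apply: wall_blocked => /=; nia.
- move=> a' z sz_a' a'z; apply: (guarded_blocked (c :: a')); rewrite /= ?sz_a' //.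
  by exists b; rewrite of_localK.
- by rewrite /penalty; case: (b); lia.
Qed.

(** * Sweeping the grid *)

(** Local coordinates refine those of the grid so that phi is 24 times a grid
    coordinate, and guide is 32 times phi, whence 768 = 24 * 32.  It exceeds
    32 + 15 * 49 = 767, so a cop following this position has speed at most 1. The
    offset o distributes the cops of a group over the 24 * 24 vertices around its
    position, which cover a level 0 unit. *)
Definition plan_coord (phi : point -> Z) (a : seq cluster) (o : nat) (w : point) : Z :=
  guide a phi 0 w / 768 + Z.of_nat o - 12.

Definition free (k : nat) (w : point) : Prop :=
  1 <= w.2 /\ forall a : k.-tuple cluster, ~ guarded a w.

Lemma strip_not_free k z : 0 <= z.1 < len k -> -49 < z.2 <= 49 -> ~ free k z.
Proof.
move=> z1 z2 [z2_ge unguarded].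
have [a /eqP sz_a aP] := strip_guarded k z z1 ltac:(lia).
exact: (unguarded (Tuple sz_a)).
Qed.

Lemma div_step x y : Z.abs (x - y) <= 768 -> Z.abs (x / 768 - y / 768) <= 1.
Proof.
have := Z.div_mod x 768; have := Z.mod_pos_bound x 768.
have := Z.div_mod y 768; have := Z.mod_pos_bound y 768.
lia.
Qed.

Lemma plan_coord_step k (phi phi' : point -> Z) (a : k.-tuple cluster) o w w' :
  (forall z, Z.abs (phi z - phi' z) <= 1) -> free k w -> l1 w w' <= 49 ->
  Z.abs (plan_coord phi a o w - plan_coord phi' a o w') <= 1.
Proof.
move=> phi_phi' free_w step_w.
have gstep : Z.abs (guide a phi 0 w - guide a phi' 0 w') <= 32 + 15 * 49.
  apply: (guide_step _ (free k)) => //; first by rewrite size_tuple; apply: strip_not_free.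
  rewrite size_tuple => a' z sz_a' a'z [_ unguarded].
  by move/eqP: sz_a' => sz_a'; apply: (unguarded (Tuple sz_a')).
have := div_step (guide a phi 0 w) (guide a phi' 0 w') ltac:(lia).
by rewrite /plan_coord; lia.
Qed.

Lemma plan_coord_start k (phi : point -> Z) (a : k.-tuple cluster) (o : 'I_24) w :
  nonexpansive phi -> phi (0, 0) <= - 9 * len k -> plan_coord phi a o w < 0.
Proof.
move=> phi1 phi0; have := guide_upper a phi 0 w phi1.
rewrite /plan_coord size_tuple; have := len_ge k; have := ltn_ord o.
have := Z.div_mod (guide a phi 0 w) 768; have := Z.mod_pos_bound (guide a phi 0 w) 768.
by move: (guide _ _ _ _) => g; lia.
Qed.

Lemma plan_coord_hit k (phi : point -> Z) (a : k.-tuple cluster) w x :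
  nonexpansive phi -> guarded a w -> phi w = 24 * x ->
  exists o : 'I_24, plan_coord phi a o w = x.
Proof.
move=> phi1 aw phi_w; have [pi val [near_w _]] := guide_value a phi w phi1 aw.
have div_pi : guide a phi 0 w / 768 = pi / 24.
  by rewrite val (_ : 768 = 32 * 24) // Z.div_mul_cancel_l; lia.
have := Z.div_mod pi 24; have := Z.mod_pos_bound pi 24 => pi_mod pi_eq.
have lt_o : (Z.to_nat (x - pi / 24 + 12) < 24)%N by lia.
by exists (Ordinal lt_o); rewrite /plan_coord div_pi /=; lia.
Qed.

(** Places outside the grid are replaced by the nearest vertex, which keeps moves legal
    and never matters where the robber is. *)
Definition cell (n : nat) (z : Z) : 'I_n.+1 := inord (Z.to_nat (Z.min z (Z.of_nat n))).

Lemma cellE n z : Z.of_nat (cell n z) = Z.max 0 (Z.min z (Z.of_nat n)).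
Proof. by rewrite /cell inordK; lia. Qed.

Section Sweep.

Variables (n k : nat).
Hypothesis len_k : 24 * Z.of_nat n < len k.

(** The position of x relative to the maze at time t, in coordinates refined by 12.
    The maze moves upwards by 1 in each turn, and is 10 * len k below the grid at
    first.  A step of the robber has length at most 4 * 12, or 49 with the motion of
    the maze. *)
Definition frame (t : nat) (x : grid n.+1) : point :=
  let: (x1, x2) := (Z.of_nat x.1, Z.of_nat x.2) in
  (12 * (x1 - x2) + 12 * Z.of_nat n, 12 * (x1 + x2) + 10 * len k - Z.of_nat t).

(** At [frame t x], the next two functions are 24 times the coordinates of x. *)
Definition coord1 (t : nat) (z : point) : Z :=
  z.1 - 12 * Z.of_nat n + (z.2 - 10 * len k + Z.of_nat t).

Definition coord2 (t : nat) (z : point) : Z :=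
  z.2 - 10 * len k + Z.of_nat t - (z.1 - 12 * Z.of_nat n).

Definition cop : finType := (k.-tuple cluster * ('I_24 * 'I_24))%type.

Definition plan (t : nat) (x : grid n.+1) (i : cop) : grid n.+1 :=
  let w := frame t x in
  (cell n (plan_coord (coord1 t) i.1 i.2.1 w),
   cell n (plan_coord (coord2 t) i.1 i.2.2 w)).

Lemma coord1_nonexpansive t : nonexpansive (coord1 t).
Proof. by move=> z z'; rewrite /coord1 /l1; lia. Qed.

Lemma coord2_nonexpansive t : nonexpansive (coord2 t).
Proof. by move=> z z'; rewrite /coord2 /l1; lia. Qed.

Lemma plan_hit t x a : guarded (a : k.-tuple cluster) (frame t x) ->
  exists i, plan t x i = x.
Proof.
move=> ax; have cellK (i : 'I_n.+1) : cell n (Z.of_nat i) = i.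
  by apply: ord_inj; have := cellE n (Z.of_nat i); have := ltn_ord i; lia.
have [o1 hit1] := plan_coord_hit _ _ a _ (Z.of_nat x.1) (coord1_nonexpansive t) ax
  ltac:(rewrite /coord1 /frame /=; lia).
have [o2 hit2] := plan_coord_hit _ _ a _ (Z.of_nat x.2) (coord2_nonexpansive t) ax
  ltac:(rewrite /coord2 /frame /=; lia).
by exists (a, (o1, o2)); rewrite /plan /= hit1 hit2 !cellK -surjective_pairing.
Qed.

Definition near (d : Z) (x y : grid n.+1) : Prop :=
  Z.abs (Z.of_nat x.1 - Z.of_nat y.1) <= d /\ Z.abs (Z.of_nat x.2 - Z.of_nat y.2) <= d.

Lemma near_refl d x : 0 <= d -> near d x x.
Proof. by rewrite /near; lia. Qed.

Lemma near_trans d d' x y z : near d x y -> near d' y z -> near (d + d') x z.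
Proof. by rewrite /near; lia. Qed.

Lemma near_adj x y : near 1 x y -> y = x \/ grid_adj x y.
Proof.
move=> xy; have [->|y_neq_x] := eqVneq y x; [by left | right].
by rewrite /grid_adj eq_sym y_neq_x /differ_le1; case: xy; lia.
Qed.

Lemma plan_step t x y : free k (frame t x) -> l1 (frame t x) (frame t.+1 y) <= 49 ->
  forall i, near 1 (plan t x i) (plan t.+1 y i).
Proof.
move=> free_x step_xy [a [o1 o2]]; rewrite /near /plan /= !cellE.
have := @plan_coord_step k (coord1 t) (coord1 t.+1) a o1 _ _ _ free_x step_xy.
have := @plan_coord_step k (coord2 t) (coord2 t.+1) a o2 _ _ _ free_x step_xy.
move=> /(_ ltac:(by rewrite /coord2; lia)) step2.
move=> /(_ ltac:(by rewrite /coord1; lia)) step1.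
by split; [move: step1 | move: step2];
  move: (plan_coord _ _ _ _) (plan_coord _ _ _ _) => u v; lia.
Qed.

Lemma dist_le2_frame t x y : dist_le (@grid_adj n.+1) 2 x y ->
  l1 (frame t x) (frame t.+1 y) <= 49.
Proof.
have adj_near u v : grid_adj u v -> near 1 u v.
  by rewrite /grid_adj /differ_le1 /near; case/and3P; lia.
suff step2 : dist_le (@grid_adj n.+1) 2 x y -> near 2 x y.
  by move=> /step2; rewrite /near /l1 /frame /=; lia.
case=> [[|u [|v [|? p]]]] [] //=.
- by move=> _ <- _; apply: near_refl.
- by rewrite andbT => /adj_near xu <- _; apply: (near_trans 1 1) xu (near_refl _ _ _).
- by case/and3P => /adj_near xu /adj_near uv _ <- _; apply: (near_trans 1 1) xu uv.
Qed.

(** As long as the robber is free, he is in front of the maze: its bottom strip spans the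
    whole grid and is as deep as a step.  But at time 34 * len k the grid is
    behind the maze. *)
Lemma robber_reaches_guard (r : nat -> grid n.+1) :
  robber_play (@grid_adj n.+1) 2 r ->
  exists t, (exists a : k.-tuple cluster, guarded a (frame t (r t))) /\
    forall u, (u < t)%N -> free k (frame u (r u)).
Proof.
move=> r_play; have k_ge := len_ge k.
pose reached t := exists a : k.-tuple cluster, guarded a (frame t (r t)).
apply: NNPP => never.
have {}never t : (forall u, (u < t)%N -> free k (frame u (r u))) -> ~ reached t.
  by move=> before hit; apply: never; exists t.
suff free_upto t u : (u < t)%N -> free k (frame u (r u)).
  have [] := free_upto _ (Z.to_nat (34 * len k)) (ltnSn _).
  by case: (r _) => [[x1 lt_x1] [x2 lt_x2]]; rewrite /frame /=; lia.
elim: t u => [//|t IH] u; rewrite ltnS leq_eqVlt => /predU1P[->|]; last exact: IH.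
split; last by move=> a aP; apply: (never t IH); exists a.
case: t IH => [|t] IH; first by rewrite /frame /=; lia.
have [//|below] := Z.le_gt_cases 1 (frame t.+1 (r t.+1)).2.
have free_t := IH t (ltnSn t); have [above _] := free_t.
have := dist_le2_frame t _ _ (r_play t); rewrite /l1 => step.
case: (strip_not_free k (frame t (r t)) _ _ free_t); last by lia.
by case: (r t) => [[x1 lt_x1] [x2 lt_x2]]; rewrite /frame /=; lia.
Qed.

End Sweep.

(** * Counting the cops *)

Lemma lenE k : len k = 200 * Z.of_nat (160 ^ k).
Proof. by elim: k => [|k IH] //=; rewrite IH expnS; lia. Qed.

Lemma expn_Z m k : Z.of_nat (m ^ k) = Z.pow (Z.of_nat m) (Z.of_nat k).
Proof.
elim: k => [|k IH] //; rewrite expnS Nat2Z.inj_mul IH Nat2Z.inj_succ Z.pow_succ_r //.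
exact: Nat2Z.is_nonneg.
Qed.

Lemma leq_exp_Z m k m' k' :
  Z.of_nat m ^ Z.of_nat k <=? Z.of_nat m' ^ Z.of_nat k' -> (m ^ k <= m' ^ k')%N.
Proof. by move=> /Z.leb_le; rewrite -!expn_Z; move: (m ^ k)%N (m' ^ k')%N; lia. Qed.

Lemma exponent_bound : (157 ^ 1000 <= 160 ^ 999)%N.
Proof. by apply: leq_exp_Z; vm_compute. Qed.

Lemma sweep_wins n k : (n < 160 ^ k)%N ->
  cops_win (@grid_adj n.+1) 2 (157 ^ k * 576)%N.
Proof.
move=> n_lt.
have len_k : 24 * Z.of_nat n < len k by rewrite lenE; lia.
have -> : (157 ^ k * 576)%N = #|{: cop k}|.
  by rewrite card_prod card_tuple !card_prod !card_sum !card_ord.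
apply: (@cops_win_of_plan _ _ _ _ (ord0, ord0) (plan n k)) => r r_play; split.
  move=> [a [o1 o2]]; rewrite /plan /=.
  have below z : z < 0 -> cell n z = ord0.
    by move=> z_lt0; apply: ord_inj => /=; have := cellE n z; lia.
  congr pair; apply/below/plan_coord_start.
  - exact: coord1_nonexpansive.
  - by rewrite /coord1 /=; lia.
  - exact: coord2_nonexpansive.
  - by rewrite /coord2 /=; lia.
have [t [[a hit] before]] := robber_reaches_guard n k len_k r r_play.
exists t; split; first exact: plan_hit hit.
move=> u lt_ut i; apply: near_adj; apply: plan_step (before u lt_ut) _ _.
exact: dist_le2_frame.
Qed.

End Maze.

Local Open Scope ring_scope.

Lemma expn_le_powR (R : realType) (a b p q j n : nat) : (0 < q)%N ->
  (a ^ q <= b ^ p)%N -> (b ^ j <= n)%N -> (a ^ j)%:R <= n%:R `^ (p%:R / q%:R) :> R.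
Proof.
move=> q_gt0 aq_le_bp bj_le_n.
have -> : (a ^ j)%:R = ((a ^ j)%:R ^+ q) `^ q%:R^-1 :> R.
  by rewrite -powR_mulrn // -powRrM mulfV ?powRr1 // pnatr_eq0 -lt0n.
rewrite powRrM powR_mulrn //; apply: ge0_ler_powR; rewrite ?nnegrE ?invr_ge0 ?exprn_ge0 //.
rewrite -!natrX ler_nat -expnM mulnC expnM.
apply: (@leq_trans ((b ^ p) ^ j)).
  by have [->|j_gt0] := posnP j; rewrite ?expn0 // leq_exp2r.
rewrite -expnM mulnC expnM; have [->|p_gt0] := posnP p; rewrite ?expn0 //.
by rewrite leq_exp2r.
Qed.

Theorem corollary4p1 (R : realType) :
  exists C : R, 0 < C /\
  exists n0 : nat, forall n : nat, (n0 <= n)%N ->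
  exists m : nat,
    m%:R <= C * n%:R `^ (999%:R / 1000%:R) /\
    cops_win (@grid_adj n) 2 m.
Proof.
exists (157 * 576)%:R; split; first by rewrite ltr0n.
(* One level more than the logarithm of n, so that the bottom of the maze is longer
   than the diagonal of the grid. *)
exists 1%N => -[//|n _]; set j := trunc_log 160 n.+1.
exists (157 ^ j.+1 * 576)%N; split; last first.
  by apply: sweep_wins; apply: ltnW; apply: trunc_log_ltn.
rewrite expnS mulnAC natrM ler_wpM2l ?ler0n //.
have n_ge : (160 ^ j <= n.+1)%N by apply: trunc_logP.
exact: (expn_le_powR R _ _ _ _ _ _ (ltn0Sn _) exponent_bound n_ge).
Qed.
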